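(* Let $\beta>-1$, $n\ge1$, and let $S_n(z;\beta)=z\frac{d}{dz}\ln\Delta_n(z;\beta)$ where $\Delta_n(z;\beta)=\big[\Gamma(\beta+1)\big]^n\,\mathcal{W}_n\big(z^{-\beta/2}I_\beta(2\sqrt z)\big)$. Then $S=S_n$ satisfies $$\Big(z\frac{d^2S}{dz^2}\Big)^2=\Big[n-(n+\beta)\frac{dS}{dz}\Big]^2-4\frac{dS}{dz}\Big(\frac{dS}{dz}-1\Big)\Big[z\frac{dS}{dz}-S+\tfrac12 n(n-1)\Big].$$
   Context: $I_\beta$ is the modified Bessel function of the first kind; $\delta_z= z\,\frac{d}{dz}$; for smooth $\psi$, $\mathcal{W}_n(\psi)=\det[\delta_z^{\,j+k}\psi]_{j,k=0}^{n-1}$. (This $\Delta_n$ is the Hankel determinant of moments of the weight $z^k/((\beta+1)_k k!)$ on $\mathbb{N}$.) *)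

(* Defs.v *)
From Stdlib Require Import Reals Arith Factorial Classical ClassicalEpsilon.
Open Scope R_scope.

Definition Deriv (f : R -> R) (x : R) : R :=
  epsilon (inhabits 0) (fun l => derivable_pt_lim f x l).

Definition series (a : nat -> R) : R :=
  epsilon (inhabits 0) (fun l => infinite_sum a l).

Definition seq_lim (u : nat -> R) : R :=
  epsilon (inhabits 0) (fun l => Un_cv u l).

Fixpoint rprod (x : R) (m : nat) : R :=
  match m with
  | O => x
  | S m' => rprod x m' * (x + INR m)
  end.

(* Euler's Gamma function via the Gauss/Euler limit formula (for x > 0):
   Gamma x = lim_m m! m^x / (x (x+1) ... (x+m)). *)
Definition Gamma (x : R) : R :=
  seq_lim (fun m => INR (fact m) * Rpower (INR m) x / rprod x m).

Definition BesselI (beta x : R) : R :=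
  series (fun k => Rpower (x / 2) (2 * INR k + beta)
                   / (INR (fact k) * Gamma (INR k + beta + 1))).

Definition delta (f : R -> R) : R -> R := fun z => z * Deriv f z.
Fixpoint delta_iter (m : nat) (f : R -> R) : R -> R :=
  match m with
  | O => f
  | S m' => delta (delta_iter m' f)
  end.

(* Determinant of the n x n matrix (A i j)_{i,j=0}^{n-1}, by Laplace
   expansion along the first row. *)
Fixpoint det (n : nat) (A : nat -> nat -> R) : R :=
  match n with
  | O => 1
  | S n' =>
      sum_f_R0 (fun j =>
        (-1) ^ j * A O j *
        det n' (fun i k => A (S i) (if Nat.ltb k j then k else S k))) n'
  end.

Definition Wronsk (n : nat) (psi : R -> R) (z : R) : R :=
  det n (fun j k => delta_iter (j + k) psi z).

Definition psi_beta (beta : R) (z : R) : R :=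
  Rpower z (- beta / 2) * BesselI beta (2 * sqrt z).

Definition Delta (n : nat) (beta z : R) : R :=
  (Gamma (beta + 1)) ^ n * Wronsk n (psi_beta beta) z.

Definition Sn (n : nat) (beta z : R) : R :=
  z * Deriv (fun x => ln (Delta n beta x)) z.

(* Main.v *)
(** Put delta = z d/dz, and let m_k = delta^k phi with phi = sum_i z^i / (i! (beta+1)_i), so that
    Delta_n = det (m_(j+k)).  With P_j the monic orthogonal polynomials of the weight
    z^i / (i! (beta+1)_i) on the natural numbers, Delta_n = h_0 ... h_(n-1) where h_j > 0 is the
    squared norm of P_j, and the recurrence coefficients a_j, b_j (with b_j = h_j / h_(j-1)) obey
    the Toda equations delta h_j = a_j h_j, delta a_j = b_(j+1) - b_j.  Hence
    S_n = a_0 + ... + a_(n-1) and delta S_n = b_n.  The Bessel equation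
    delta (delta + beta) phi = z phi expands P_n(x+1) in P_n, P_(n-1), P_(n-2), which gives

      b_n (a_n + a_(n-1) + beta - n + 1) = n z,
      b_n b_(n+1) = b_n b_(n-1) + n z (1 + a_(n-1) - a_n).

    Induction on n turns these into
    (b_(n+1) - z) (b_n - z) = z (a_n - n) (a_n - n + beta) and
    z (S_n - n (n-1) / 2) = b_n b_(n+1) + n z (a_n - n);
    as (delta b_n) / b_n = a_n - a_(n-1), eliminating b_(n+1), a_n and a_(n-1) is the theorem. *)

From Stdlib Require Import Reals ClassicalEpsilon Factorial Lra Lia.
From mathcomp Require all_boot all_algebra Rstruct.
From Coquelicot Require Import Coquelicot.
Require Import Defs.
Open Scope R_scope.

(** * The Gamma function *)

Lemma ln_sub_le (x y : R) : 0 < x -> 0 < y -> ln y - ln x <= (y - x) / x.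
Proof.
  intros Hx Hy.
  rewrite <- (ln_div y x) by assumption.
  pose proof (exp_ineq1_le (ln (y / x))) as H.
  rewrite exp_ln in H by (apply Rdiv_lt_0_compat; assumption).
  replace ((y - x) / x) with (y / x - 1) by (field; lra). lra.
Qed.

Lemma rprod_pos (x : R) (m : nat) : 0 < x -> 0 < rprod x m.
Proof.
  intros Hx; induction m as [|m IH]; [exact Hx|].
  cbn [rprod]. apply Rmult_lt_0_compat; [exact IH|].
  pose proof (pos_INR (S m)); lra.
Qed.

Lemma rprod_succ_l (x : R) (m : nat) : rprod x (S m) = x * rprod (x + 1) m.
Proof.
  induction m as [|m IH]; [cbn [rprod]; simpl; ring|].
  change (rprod x (S m) * (x + INR (S (S m))) = x * (rprod (x + 1) m * (x + 1 + INR (S m)))).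
  rewrite IH, !S_INR. ring.
Qed.

Definition gauss (x : R) (m : nat) : R :=
  INR (fact m) * Rpower (INR m) x / rprod x m.

Definition ln_gauss (x : R) (m : nat) : R :=
  ln (INR (fact m)) + x * ln (INR m) - ln (rprod x m).

Lemma gauss_exp (x : R) (m : nat) : 0 < x -> gauss x m = exp (ln_gauss x m).
Proof.
  intros Hx. unfold gauss, ln_gauss, Rpower.
  unfold Rminus. rewrite !exp_plus, exp_Ropp, !exp_ln; [reflexivity| |].
  - apply rprod_pos, Hx.
  - apply INR_fact_lt_0.
Qed.

(** With M = [INR (S m)], the step is x ln((M+1)/M) - ln(1 + x/(M+1)), and both bounds come from ln
    t <= t - 1. The upper bound telescopes, so the increasing sequence of logarithms is bounded. *)
Lemma ln_gauss_step (x : R) (m : nat) : 0 < x ->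
  0 <= ln_gauss x (S (S m)) - ln_gauss x (S m)
    <= x * (x + 1) * (/ INR (S m) - / INR (S (S m))).
Proof.
  intros Hx.
  assert (HM : 0 < INR (S m)) by apply lt_0_INR, Nat.lt_0_succ.
  assert (HM' : 0 < INR (S (S m))) by apply lt_0_INR, Nat.lt_0_succ.
  assert (Hf := INR_fact_lt_0 (S m)).
  unfold ln_gauss.
  change (rprod x (S (S m))) with (rprod x (S m) * (x + INR (S (S m)))).
  change (fact (S (S m))) with (S (S m) * fact (S m))%nat.
  rewrite mult_INR, !ln_mult; try assumption; try lra; try apply rprod_pos, Hx.
  rewrite (S_INR (S m)) in HM' |- *. set (M := INR (S m)) in *.
  pose proof (ln_sub_le M (M + 1) HM HM') as H1.
  pose proof (ln_sub_le (M + 1) M HM' HM) as H2.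
  assert (Hxm : 0 < x + (M + 1)) by lra.
  pose proof (ln_sub_le (M + 1) (x + (M + 1)) HM' Hxm) as H3.
  pose proof (ln_sub_le (x + (M + 1)) (M + 1) Hxm HM') as H4.
  apply (Rmult_le_compat_l x) in H1; [|lra].
  apply (Rmult_le_compat_l x) in H2; [|lra].
  replace (x * ((M + 1 - M) / M)) with (x / M) in H1 by (field; lra).
  replace (x * ((M - (M + 1)) / (M + 1))) with (- (x / (M + 1))) in H2 by (field; lra).
  replace ((x + (M + 1) - (M + 1)) / (M + 1)) with (x / (M + 1)) in H3 by (field; lra).
  split; [lra|].
  assert (H5 : x / M + (M + 1 - (x + (M + 1))) / (x + (M + 1))
               <= x * (x + 1) * (/ M - / (M + 1))).
  { replace (x / M + (M + 1 - (x + (M + 1))) / (x + (M + 1)))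
      with (x * (x + 1) * / (M * (x + (M + 1)))) by (field; lra).
    replace (/ M - / (M + 1)) with (/ (M * (M + 1))) by (field; lra).
    apply Rmult_le_compat_l; [nra|].
    apply Rinv_le_contravar; nra. }
  lra.
Qed.

Lemma gauss_cv (x : R) : 0 < x -> exists l, 0 < l /\ Un_cv (gauss x) l.
Proof.
  intros Hx.
  assert (Hb : forall n, ln_gauss x (S n) <= ln_gauss x 1 + x * (x + 1) * (1 - / INR (S n))).
  { induction n as [|n IH]; [simpl; lra|].
    pose proof (ln_gauss_step x n Hx). lra. }
  destruct (ex_finite_lim_seq_incr (fun n => ln_gauss x (S n)) (ln_gauss x 1 + x * (x + 1)))
    as [l Hl].
  - intros n. pose proof (ln_gauss_step x n Hx). lra.
  - intros n. specialize (Hb n).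
    assert (0 < / INR (S n)) by (apply Rinv_0_lt_compat, lt_0_INR, Nat.lt_0_succ).
    assert (0 < x * (x + 1)) by nra. nra.
  - exists (exp l). split; [apply exp_pos|].
    apply is_lim_seq_Reals, is_lim_seq_incr_1.
    apply is_lim_seq_ext with (fun n => exp (ln_gauss x (S n))).
    { intros n. symmetry. apply gauss_exp, Hx. }
    apply (is_lim_seq_continuous exp); [apply derivable_continuous_pt, derivable_pt_exp|exact Hl].
Qed.

(** Once some limit exists, [epsilon] returns a limit, and uniqueness carries positivity over to
    it. *)
Lemma Gamma_spec (x : R) : 0 < x -> 0 < Gamma x /\ Un_cv (gauss x) (Gamma x).
Proof.
  intros Hx. destruct (gauss_cv x Hx) as [l [Hl Hcv]].
  assert (H : Un_cv (gauss x) (Gamma x))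
    by (apply (epsilon_spec (inhabits 0) (fun l => Un_cv (gauss x) l)); exists l; exact Hcv).
  split; [|exact H].
  rewrite (UL_sequence _ _ _ H Hcv). exact Hl.
Qed.

(** For m >= 1, [gauss (x + 1) m] is x times [gauss x m] times m/(x+1+m); this last factor, written
    1 - (x+1)/(x+1+m), tends to 1. *)
Lemma Gamma_succ (x : R) : 0 < x -> Gamma (x + 1) = x * Gamma x.
Proof.
  intros Hx.
  destruct (Gamma_spec x Hx) as [_ H1].
  destruct (Gamma_spec (x + 1)) as [_ H2]; [lra|].
  apply is_lim_seq_Reals in H1. apply is_lim_seq_Reals in H2.
  assert (H3 : is_lim_seq (fun m => x * gauss x (S m) * (1 - (x + 1) * / (x + 1 + INR (S m))))
                 (x * Gamma x * (1 - (x + 1) * 0))).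
  { apply is_lim_seq_mult'.
    - apply is_lim_seq_mult'; [apply is_lim_seq_const|].
      now apply (is_lim_seq_incr_1 (gauss x)).
    - apply is_lim_seq_minus'; [apply is_lim_seq_const|].
      apply is_lim_seq_mult'; [apply is_lim_seq_const|].
      change (Finite 0) with (Rbar_inv p_infty).
      apply (is_lim_seq_inv _ p_infty); [|discriminate].
      apply (is_lim_seq_plus _ _ (x + 1) p_infty); [apply is_lim_seq_const| |reflexivity].
      apply (is_lim_seq_incr_1 INR), is_lim_seq_INR. }
  apply is_lim_seq_incr_1 in H2.
  apply (is_lim_seq_ext _ (fun m => gauss (x + 1) (S m))) in H3.
  - apply is_lim_seq_unique in H2. apply is_lim_seq_unique in H3.
    rewrite H2 in H3. injection H3 as H3. rewrite H3. ring.
  - intros m. unfold gauss.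
    assert (HM : 0 < INR (S m)) by apply lt_0_INR, Nat.lt_0_succ.
    assert (HP := rprod_pos x (S m) Hx).
    assert (HP' : 0 < rprod (x + 1) (S m)) by (apply rprod_pos; lra).
    assert (E : x * rprod (x + 1) (S m) = rprod x (S m) * (x + 1 + INR (S m))).
    { rewrite <- rprod_succ_l. change (rprod x (S (S m))) with (rprod x (S m) * (x + INR (S (S m)))).
      rewrite (S_INR (S m)). ring. }
    rewrite Rpower_plus, Rpower_1 by exact HM.
    replace (rprod x (S m)) with (x * rprod (x + 1) (S m) / (x + 1 + INR (S m)))
      by (rewrite E; field; lra).
    field. lra.
Qed.

(** This is 1 / (i! (beta+1)_i). The recursive form exposes the ratio of consecutive terms, on which
    the ratio test and the Bessel equation rest. *)
Fixpoint coef (beta : R) (i : nat) : R :=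
  match i with
  | O => 1
  | S i' => coef beta i' / (INR (S i') * (INR (S i') + beta))
  end.

Lemma coef_pos (beta : R) (i : nat) : -1 < beta -> 0 < coef beta i.
Proof.
  intros Hb; induction i as [|i IH]; [simpl; lra|].
  cbn [coef]. rewrite S_INR. pose proof (pos_INR i).
  apply Rdiv_lt_0_compat; [exact IH|]. apply Rmult_lt_0_compat; lra.
Qed.

Lemma coef_Gamma (beta : R) (i : nat) : -1 < beta ->
  / (INR (fact i) * Gamma (INR i + beta + 1)) = coef beta i / Gamma (beta + 1).
Proof.
  intros Hb.
  assert (H0 : 0 < Gamma (beta + 1)) by (apply Gamma_spec; lra).
  induction i as [|i IH].
  - simpl. rewrite Rplus_0_l. field. lra.
  - assert (Hi := pos_INR i). assert (Hf := INR_fact_lt_0 i).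
    assert (HG : 0 < Gamma (INR i + beta + 1)) by (apply Gamma_spec; lra).
    cbn [coef]. change (fact (S i)) with (S i * fact i)%nat.
    rewrite mult_INR, S_INR.
    replace (INR i + 1 + beta + 1) with ((INR i + beta + 1) + 1) by ring.
    rewrite Gamma_succ by lra.
    transitivity (/ (INR (fact i) * Gamma (INR i + beta + 1)) / ((INR i + 1) * (INR i + 1 + beta))).
    + field. repeat split; lra.
    + rewrite IH. field. repeat split; lra.
Qed.

(** * The moments *)

(* If [s k = L x^k] for a linear functional [L], then [shiftT k s = L (x+1)^k]. *)
Fixpoint shiftT (k : nat) (s : nat -> R) : R :=
  match k with
  | O => s O
  | S k' => shiftT k' s + shiftT k' (fun l => s (S l))
  end.

Lemma shiftT_ext (k : nat) (s t : nat -> R) :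
  (forall l, s l = t l) -> shiftT k s = shiftT k t.
Proof.
  revert s t; induction k as [|k IH]; intros s t H; simpl; [apply H|].
  rewrite (IH s t H), (IH _ (fun l => t (S l)) (fun l => H (S l))). reflexivity.
Qed.

Lemma shiftT_lin (k : nat) (a b : R) (s t : nat -> R) :
  shiftT k (fun l => a * s l + b * t l) = a * shiftT k s + b * shiftT k t.
Proof.
  revert s t; induction k as [|k IH]; intros s t; simpl; [reflexivity|].
  rewrite (IH s t), (IH (fun l => s (S l)) (fun l => t (S l))). ring.
Qed.

(** By the binomial theorem [shiftT k s] is the sum of binom(k,l) s_l, so only the top entry
    survives; in the next lemma the top two do. *)
Lemma shiftT_low (k : nat) (s : nat -> R) :
  (forall l, (l < k)%nat -> s l = 0) -> shiftT k s = s k.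
Proof.
  revert s; induction k as [|k IH]; intros s H; simpl; [reflexivity|].
  rewrite !IH, (H k); [ring|lia| |]; intros; apply H; lia.
Qed.

Lemma shiftT_low_succ (k : nat) (s : nat -> R) :
  (forall l, (l < k)%nat -> s l = 0) ->
  shiftT (S k) s = s (S k) + INR (S k) * s k.
Proof.
  revert s; induction k as [|k IH]; intros s H; [simpl; ring|].
  change (shiftT (S (S k)) s) with (shiftT (S k) s + shiftT (S k) (fun l => s (S l))).
  rewrite (IH (fun l => s (S l))) by (intros; apply H; lia).
  rewrite (shiftT_low (S k) s) by exact H.
  rewrite (S_INR (S k)). ring.
Qed.

Lemma is_derive_shiftT (k : nat) (s : R -> nat -> R) (ds : nat -> R) (x : R) :
  (forall l, is_derive (fun y => s y l) x (ds l)) ->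
  is_derive (fun y => shiftT k (s y)) x (shiftT k ds).
Proof.
  revert s ds; induction k as [|k IH]; intros s ds H; simpl; [apply H|].
  apply (is_derive_plus (fun y => shiftT k (s y)) (fun y => shiftT k (fun l => s y (S l)))).
  - apply IH, H.
  - apply IH. intros l. apply H.
Qed.

(** Since delta multiplies the coefficient of x^i by i, these are the coefficients of delta^k phi;
    0^0 = 1 makes k = 0 give phi itself. *)
Definition mom_coef (beta : R) (k i : nat) : R := coef beta i * INR i ^ k.

Definition mom (beta x : R) (k : nat) : R := PSeries (mom_coef beta k) x.

(** Applying delta is differentiating and then multiplying by x; in this form the general facts on
    power series give both the radius of convergence and the derivative. *)
Lemma mom_coef_succ (beta : R) (k i : nat) :
  mom_coef beta (S k) i = PS_incr_1 (PS_derive (mom_coef beta k)) i.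
Proof.
  unfold mom_coef, PS_incr_1, PS_derive. destruct i as [|i].
  - transitivity 0; [simpl; rewrite Rmult_0_l; apply Rmult_0_r | reflexivity].
  - rewrite <- tech_pow_Rmult. ring.
Qed.

Lemma CV_radius_mom (beta : R) (k : nat) : -1 < beta -> CV_radius (mom_coef beta k) = p_infty.
Proof.
  intros Hb. induction k as [|k IH].
  - rewrite (CV_radius_ext _ (coef beta)) by (intros i; unfold mom_coef; simpl; ring).
    apply CV_radius_infinite_DAlembert.
    { intros i. pose proof (coef_pos beta i Hb). lra. }
    apply is_lim_seq_le_le with (fun _ => 0) (fun i => / (1 + beta) * / INR (S i)).
    + intros i. assert (Hi := pos_INR i). assert (Hc := coef_pos beta i Hb).
      cbn [coef]. rewrite S_INR.
      replace (coef beta i / ((INR i + 1) * (INR i + 1 + beta)) / coef beta i)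
        with (/ ((1 + beta + INR i) * (INR i + 1))) by (field; repeat split; lra).
      assert (0 < (1 + beta + INR i) * (INR i + 1)) by (apply Rmult_lt_0_compat; lra).
      rewrite Rabs_pos_eq by (apply Rlt_le, Rinv_0_lt_compat; assumption).
      split; [apply Rlt_le, Rinv_0_lt_compat; assumption|].
      rewrite <- Rinv_mult. apply Rinv_le_contravar; [apply Rmult_lt_0_compat; lra|].
      apply Rmult_le_compat_r; lra.
    + apply is_lim_seq_const.
    + replace (Finite 0) with (Rbar_mult (/ (1 + beta)) 0) by (simpl; f_equal; ring).
      apply is_lim_seq_scal_l.
      change (Finite 0) with (Rbar_inv p_infty).
      apply (is_lim_seq_inv _ p_infty); [|discriminate].
      apply (is_lim_seq_incr_1 INR), is_lim_seq_INR.
  - rewrite (CV_radius_ext _ _ (mom_coef_succ beta k)).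
    rewrite CV_radius_incr_1, CV_radius_derive. exact IH.
Qed.

Lemma is_derive_mom (beta x : R) (k : nat) : -1 < beta -> 0 < x ->
  is_derive (fun y => mom beta y k) x (mom beta x (S k) / x).
Proof.
  intros Hb Hx. unfold mom.
  rewrite (PSeries_ext _ _ x (mom_coef_succ beta k)), PSeries_incr_1.
  replace (x * PSeries (PS_derive (mom_coef beta k)) x / x)
    with (PSeries (PS_derive (mom_coef beta k)) x) by (field; lra).
  apply is_derive_PSeries. rewrite CV_radius_mom by exact Hb. exact I.
Qed.

Lemma ex_series_mom (beta x : R) (k : nat) : -1 < beta ->
  ex_series (fun i => mom_coef beta k i * x ^ i).
Proof.
  intros Hb. apply ex_pseries_R, CV_radius_inside.
  rewrite CV_radius_mom by exact Hb. exact I.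
Qed.

(** Induction through (x+1)^(k+1) = (x+1)^k + x (x+1)^k; the weight stays general so that the second
    summand is the same claim for the weight w_i i. *)
Lemma shiftT_Series (k : nat) (w : nat -> R) :
  (forall l, ex_series (fun i => w i * INR i ^ l)) ->
  ex_series (fun i => w i * (INR i + 1) ^ k) /\
  shiftT k (fun l => Series (fun i => w i * INR i ^ l)) = Series (fun i => w i * (INR i + 1) ^ k).
Proof.
  revert w; induction k as [|k IH]; intros w Hw.
  - split; [exact (Hw O)|reflexivity].
  - destruct (IH w Hw) as [E1 H1].
    destruct (IH (fun i => w i * INR i)) as [E2 H2].
    { intros l. apply ex_series_ext with (fun i => w i * INR i ^ S l); [|apply Hw].
      intros i; simpl; ring. }
    assert (E : forall i, w i * (INR i + 1) ^ k + w i * INR i * (INR i + 1) ^ k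
                          = w i * (INR i + 1) ^ S k) by (intros i; simpl; ring).
    split.
    + apply (ex_series_ext _ _ E). now apply (ex_series_plus (V := R_NormedModule)).
    + simpl shiftT. rewrite <- (Series_ext _ _ E), Series_plus by assumption.
      rewrite H1, <- H2. f_equal. apply shiftT_ext. intros l. apply Series_ext.
      intros i. simpl. ring.
Qed.

(* The Bessel equation [delta (delta + beta) phi = x phi], after applying [delta ^ k]. *)
Lemma mom_bessel (beta x : R) (k : nat) : -1 < beta ->
  mom beta x (S (S k)) + beta * mom beta x (S k) = x * shiftT k (mom beta x).
Proof.
  intros Hb.
  set (w := fun i => coef beta i * x ^ i).
  assert (Hm : forall l, mom beta x l = Series (fun i => w i * INR i ^ l)).
  { intros l. unfold mom, PSeries. apply Series_ext. intros i. unfold mom_coef, w. ring. }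
  assert (He : forall l, ex_series (fun i => w i * INR i ^ l)).
  { intros l. apply ex_series_ext with (2 := ex_series_mom beta x l Hb).
    intros i. unfold mom_coef, w. simpl. ring. }
  assert (Hs : ex_series (fun i => beta * (w i * INR i ^ S k)))
    by exact (ex_series_scal (V := R_NormedModule) beta _ (He (S k))).
  rewrite (shiftT_ext k _ _ Hm).
  destruct (shiftT_Series k w He) as [E1 ->].
  rewrite !Hm, <- Series_scal_l.
  rewrite <- Series_plus; [|apply He|exact Hs].
  (* The term i = 0 vanishes, and re-indexing the others uses (i+1)(i+1+beta) c_(i+1) = c_i for the
     coefficients c of phi. *)
  rewrite Series_incr_1.
  - simpl INR. rewrite <- Series_scal_l. rewrite pow_i, pow_i by lia.
    rewrite !Rmult_0_r, !Rplus_0_l.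
    apply Series_ext. intros i. unfold w. cbn [coef].
    change (match i with O => 1 | S _ => INR i + 1 end) with (INR (S i)).
    rewrite S_INR. assert (Hi := pos_INR i). simpl pow. field. split; lra.
  - apply (ex_series_plus (V := R_NormedModule)); [apply He|exact Hs].
Qed.

(** * Orthogonal polynomials *)

(* For the functional [L x^k = m k] with monic orthogonal polynomials [P_j],
   [cheb m j k = L (P_j x^k)], computed by Chebyshev's algorithm. *)
Fixpoint cheb (m : nat -> R) (j : nat) : nat -> R :=
  match j with
  | O => m
  | S i => fun k =>
      cheb m i (S k)
      - (cheb m i (S i) / cheb m i i
         - match i with O => 0 | S p => cheb m p (S p) / cheb m p p end) * cheb m i k
      - match i with O => 0 | S p => cheb m i i / cheb m p p * cheb m p k end
  end.

Definition hnorm (m : nat -> R) (j : nat) : R := cheb m j j.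

(* [gsum m j] is the sum of [alph m 0], ..., [alph m j]. *)
Definition gsum (m : nat -> R) (j : nat) : R := cheb m j (S j) / hnorm m j.

(** The coefficient a_j in x P_j = P_(j+1) + a_j P_j + b_j P_(j-1). *)
Definition alph (m : nat -> R) (j : nat) : R :=
  gsum m j - match j with O => 0 | S p => gsum m p end.

(* The recurrence coefficient usually indexed by [j + 1]: [b_(j+1) = h_(j+1) / h_j]. *)
Definition bet (m : nat -> R) (j : nat) : R := hnorm m (S j) / hnorm m j.

Lemma cheb_1 (m : nat -> R) (k : nat) :
  cheb m 1 k = cheb m 0 (S k) - alph m 0 * cheb m 0 k.
Proof. unfold alph, gsum, hnorm. simpl. ring. Qed.

Lemma cheb_SS (m : nat -> R) (j k : nat) :
  cheb m (S (S j)) k =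
  cheb m (S j) (S k) - alph m (S j) * cheb m (S j) k - bet m j * cheb m j k.
Proof. reflexivity. Qed.

Lemma nat_pair_ind (P : nat -> Prop) :
  P 0%nat -> P 1%nat -> (forall j, P j -> P (S j) -> P (S (S j))) -> forall j, P j.
Proof.
  intros H0 H1 HS j. cut (P j /\ P (S j)); [tauto|].
  induction j as [|j [IH1 IH2]]; split; auto.
Qed.

(** Orthogonality of P_j to lower powers. In the step to j + 2, [bet m j] is what cancels the entry
    k = j and [alph m (S j)] the entry k = j + 1; smaller entries vanish by induction. *)
Lemma cheb_low (m : nat -> R) (j : nat) :
  (forall i, (i < j)%nat -> hnorm m i <> 0) ->
  forall k, (k < j)%nat -> cheb m j k = 0.
Proof.
  induction j as [| |j IH1 IH2] using nat_pair_ind; intros Hh k Hk; [lia| |].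
  - replace k with 0%nat by lia. rewrite cheb_1. unfold alph, gsum, hnorm.
    specialize (Hh 0%nat Nat.lt_0_1). unfold hnorm in Hh. field. exact Hh.
  - assert (Hj : hnorm m j <> 0) by (apply Hh; lia).
    assert (Hj1 : hnorm m (S j) <> 0) by (apply Hh; lia).
    specialize (IH1 ltac:(intros; apply Hh; lia)).
    specialize (IH2 ltac:(intros; apply Hh; lia)).
    rewrite cheb_SS.
    destruct (Nat.lt_trichotomy k j) as [Hlt|[->|Hgt]].
    + rewrite (IH1 k Hlt), (IH2 k), (IH2 (S k)) by lia. ring.
    + rewrite (IH2 j) by lia. unfold bet. change (cheb m j j) with (hnorm m j).
      change (cheb m (S j) (S j)) with (hnorm m (S j)). field. exact Hj.
    + replace k with (S j) by lia. unfold alph, gsum, bet.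
      change (cheb m (S j) (S j)) with (hnorm m (S j)). field. split; assumption.
Qed.

(** * Positivity of the squared norms *)

Fixpoint opoly (m : nat -> R) (j : nat) (x : R) : R :=
  match j with
  | O => 1
  | S i => (x - alph m i) * opoly m i x
           - match i with O => 0 | S p => bet m p * opoly m p x end
  end.

Lemma opoly_SS (m : nat -> R) (j : nat) (x : R) :
  opoly m (S (S j)) x = (x - alph m (S j)) * opoly m (S j) x - bet m j * opoly m j x.
Proof. reflexivity. Qed.

Lemma ex_series_comb3 (a b : R) (u v t : nat -> R) :
  ex_series u -> ex_series v -> ex_series t ->
  ex_series (fun i => u i - a * v i - b * t i) /\
  Series (fun i => u i - a * v i - b * t i) = Series u - a * Series v - b * Series t.
Proof.
  intros Hu Hv Ht.
  assert (Hv' : ex_series (fun i => a * v i)) by exact (ex_series_scal (V := R_NormedModule) a _ Hv).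
  assert (Ht' : ex_series (fun i => b * t i)) by exact (ex_series_scal (V := R_NormedModule) b _ Ht).
  assert (Huv : ex_series (fun i => u i - a * v i))
    by exact (ex_series_minus (V := R_NormedModule) _ _ Hu Hv').
  split; [exact (ex_series_minus (V := R_NormedModule) _ _ Huv Ht')|].
  rewrite (Series_minus _ _ Huv Ht'), (Series_minus _ _ Hu Hv'), !Series_scal_l. reflexivity.
Qed.

(** This is L (x^k g P_j) for the discrete weight w. Taking g = 1 recovers [cheb]; taking g = P_j
    leads to L (P_j^2). *)
Definition mixed (m w g : nat -> R) (j k : nat) : R :=
  Series (fun i => w i * (INR i ^ k * (g i * opoly m j (INR i)))).

(** The three-term recurrence of the P_j passes through the series term by term; convergence is
    carried in the same induction because splitting the series requires it. *)
Lemma mixed_spec (m w g : nat -> R) :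
  (forall k, ex_series (fun i => w i * (INR i ^ k * g i))) ->
  forall j,
    (forall k, ex_series (fun i => w i * (INR i ^ k * (g i * opoly m j (INR i))))) /\
    match j with
    | O => forall k, mixed m w g 0 k = Series (fun i => w i * (INR i ^ k * g i))
    | S O => forall k, mixed m w g 1 k = mixed m w g 0 (S k) - alph m 0 * mixed m w g 0 k
    | S (S p) => forall k, mixed m w g (S (S p)) k =
        mixed m w g (S p) (S k) - alph m (S p) * mixed m w g (S p) k - bet m p * mixed m w g p k
    end.
Proof.
  intros Hg j.
  induction j as [| |j [IH1 _] [IH2 _]] using nat_pair_ind.
  - assert (E : forall k i, w i * (INR i ^ k * g i) = w i * (INR i ^ k * (g i * opoly m 0 (INR i))))
      by (intros; simpl; ring).
    split; intros k.
    + exact (ex_series_ext _ _ (E k) (Hg k)).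
    + symmetry. exact (Series_ext _ _ (E k)).
  - assert (H0 : forall k, ex_series (fun i => w i * (INR i ^ k * (g i * opoly m 0 (INR i))))).
    { intros k. apply ex_series_ext with (2 := Hg k). intros i. simpl. ring. }
    assert (E : forall k i, w i * (INR i ^ S k * (g i * opoly m 0 (INR i)))
       - alph m 0 * (w i * (INR i ^ k * (g i * opoly m 0 (INR i))))
       - 0 * (w i * (INR i ^ k * (g i * opoly m 0 (INR i))))
       = w i * (INR i ^ k * (g i * opoly m 1 (INR i)))).
    { intros k i. simpl. ring. }
    split; intros k; destruct (ex_series_comb3 (alph m 0) 0 _ _ _ (H0 (S k)) (H0 k) (H0 k)) as [He Hs].
    + exact (ex_series_ext _ _ (E k) He).
    + unfold mixed. rewrite <- (Series_ext _ _ (E k)), Hs. ring.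
  - assert (E : forall k i, w i * (INR i ^ S k * (g i * opoly m (S j) (INR i)))
       - alph m (S j) * (w i * (INR i ^ k * (g i * opoly m (S j) (INR i))))
       - bet m j * (w i * (INR i ^ k * (g i * opoly m j (INR i))))
       = w i * (INR i ^ k * (g i * opoly m (S (S j)) (INR i)))).
    { intros k i. rewrite opoly_SS. rewrite <- tech_pow_Rmult. ring. }
    split; intros k;
      destruct (ex_series_comb3 (alph m (S j)) (bet m j) _ _ _ (IH2 (S k)) (IH2 k) (IH1 k)) as [He Hs].
    + exact (ex_series_ext _ _ (E k) He).
    + unfold mixed. rewrite <- (Series_ext _ _ (E k)), Hs. reflexivity.
Qed.

(** Supplies a point of the support where P_j is nonzero. The comparison with P_(j+1) is carried
    along so that the b term can be absorbed: past the threshold, (x - a) q - b p >= (1 + |b|) q -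
    |b| q = q. *)
Lemma opoly_eventually_pos (m : nat -> R) (j : nat) :
  exists N, forall i, (N <= i)%nat ->
    0 < opoly m j (INR i) <= opoly m (S j) (INR i).
Proof.
  assert (Hup : forall a, exists N, forall i, (N <= i)%nat -> a <= INR i).
  { intros a. destruct (INR_unbounded a) as [N HN]. exists N. intros i Hi.
    apply le_INR in Hi. lra. }
  induction j as [|j [N HN]].
  - destruct (Hup (1 + alph m 0)) as [N HN]. exists N. intros i Hi.
    specialize (HN i Hi). simpl. lra.
  - destruct (Hup (1 + alph m (S j) + Rabs (bet m j))) as [N' HN'].
    exists (N + N')%nat. intros i Hi.
    specialize (HN i ltac:(lia)). specialize (HN' i ltac:(lia)).
    rewrite opoly_SS.
    set (p := opoly m j (INR i)) in *. set (q := opoly m (S j) (INR i)) in *.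
    pose proof (Rle_abs (bet m j)). pose proof (Rabs_pos (bet m j)).
    assert (bet m j * p <= Rabs (bet m j) * q) by
      (apply Rle_trans with (Rabs (bet m j) * p);
       [apply Rmult_le_compat_r; lra | apply Rmult_le_compat_l; lra]).
    assert ((1 + Rabs (bet m j)) * q <= (INR i - alph m (S j)) * q)
      by (apply Rmult_le_compat_r; lra).
    lra.
Qed.

Lemma Series_pos_term (a : nat -> R) (N : nat) :
  (forall i, 0 <= a i) -> 0 < a N -> ex_series a -> 0 < Series a.
Proof.
  intros Ha HN He.
  rewrite (Series_incr_n a (S N)) by (try lia; assumption).
  assert (0 <= Series (fun k => a (S N + k)%nat)).
  { apply Rle_trans with (Series (fun k => 0 * a (S N + k)%nat)).
    { rewrite Series_scal_l. lra. }
    apply Series_le; [intros k; specialize (Ha (S N + k)%nat); lra|].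
    now apply (ex_series_incr_n a). }
  enough (a N <= sum_f_R0 a (pred (S N))) by lra.
  simpl pred. destruct N as [|N]; simpl; [lra|].
  enough (0 <= sum_f_R0 a N) by lra. apply cond_pos_sum, Ha.
Qed.

(** Strong induction: nonzero lower norms make P_j orthogonal to lower powers, hence h_j = L (P_j
    x^j) = L (P_j^2), a series of nonnegative terms with a positive one. *)
Lemma hnorm_pos (m w : nat -> R) :
  (forall i, 0 < w i) ->
  (forall k, ex_series (fun i => w i * INR i ^ k)) ->
  (forall k, m k = Series (fun i => w i * INR i ^ k)) ->
  forall j, 0 < hnorm m j.
Proof.
  intros Hw He Hm j. induction j as [j IH] using (well_founded_induction Nat.lt_wf_0).
  set (one := fun _ : nat => 1).
  assert (H1 : forall k, ex_series (fun i => w i * (INR i ^ k * one i))).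
  { intros k. apply ex_series_ext with (2 := He k). intros i. unfold one. simpl. ring. }
  assert (Hs : forall l k, mixed m w one l k = cheb m l k).
  { intros l. induction l as [| |l IH1 IH2] using nat_pair_ind; intros k.
    - rewrite (proj2 (mixed_spec m w one H1 0)). simpl. rewrite Hm.
      apply Series_ext. intros i. unfold one. ring.
    - rewrite (proj2 (mixed_spec m w one H1 1)), cheb_1.
      rewrite !(proj2 (mixed_spec m w one H1 0)). simpl cheb. rewrite !Hm.
      f_equal; [|f_equal]; apply Series_ext; intros i; unfold one; ring.
    - rewrite (proj2 (mixed_spec m w one H1 (S (S l)))), cheb_SS, !IH1, !IH2. reflexivity. }
  set (g := fun i => opoly m j (INR i)).
  assert (Hg : forall k, ex_series (fun i => w i * (INR i ^ k * g i))).
  { intros k. apply ex_series_ext with (2 := proj1 (mixed_spec m w one H1 j) k).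
    intros i. unfold one, g. simpl. ring. }
  assert (Hlow : forall k, (k < j)%nat -> cheb m j k = 0).
  { apply cheb_low. intros i Hi. specialize (IH i Hi). lra. }
  assert (H0 : forall k, mixed m w g 0 k = cheb m j k).
  { intros k. rewrite (proj2 (mixed_spec m w g Hg 0)), <- Hs. unfold mixed.
    apply Series_ext. intros i. unfold one, g. ring. }
  (* As x^k P_l is monic of degree l + k, its pairing with P_j is h_j in degree j and 0 below; l =
     j, k = 0 is the case wanted. *)
  assert (Hort : forall l k, (l + k <= j)%nat ->
     mixed m w g l k = if Nat.eqb (l + k) j then hnorm m j else 0).
  { intros l. induction l as [| |l IH1 IH2] using nat_pair_ind; intros k Hk.
    - rewrite H0. simpl. destruct (Nat.eqb_spec k j) as [->|]; [reflexivity|]. apply Hlow. lia.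
    - rewrite (proj2 (mixed_spec m w g Hg 1)), !H0, (Hlow k) by lia. change (1 + k)%nat with (S k).
      destruct (Nat.eqb_spec (S k) j) as [->|]; [unfold hnorm; ring|]. rewrite Hlow by lia. ring.
    - rewrite (proj2 (mixed_spec m w g Hg (S (S l)))), (IH2 (S k)), (IH2 k), (IH1 k) by lia.
      replace (S l + S k)%nat with (S (S l) + k)%nat by lia.
      rewrite (proj2 (Nat.eqb_neq (S l + k) j)), (proj2 (Nat.eqb_neq (l + k) j)) by lia. ring. }
  specialize (Hort j 0%nat ltac:(lia)). rewrite Nat.add_0_r, Nat.eqb_refl in Hort.
  rewrite <- Hort. destruct (opoly_eventually_pos m j) as [N HN].
  apply (Series_pos_term _ N).
  - intros i. unfold g. simpl. specialize (Hw i).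
    pose proof (Rle_0_sqr (opoly m j (INR i))) as Hq. unfold Rsqr in Hq.
    apply Rmult_le_pos; [lra|]. rewrite Rmult_1_l. exact Hq.
  - unfold g. simpl. specialize (HN N (le_n N)). specialize (Hw N).
    rewrite Rmult_1_l. repeat apply Rmult_lt_0_compat; lra.
  - exact (proj1 (mixed_spec m w g Hg j) 0%nat).
Qed.

(** * The Toda flow and the sigma form *)

Lemma locally_pos (x : R) (P : R -> Prop) :
  0 < x -> (forall y, 0 < y -> P y) -> locally x P.
Proof.
  intros Hx H. exists (mkposreal x Hx). intros y Hy. apply H.
  change (Rabs (y - x) < x) in Hy. apply Rabs_def2 in Hy. lra.
Qed.

Lemma is_derive_ext_pos (f g : R -> R) (x l : R) :
  0 < x -> (forall y, 0 < y -> f y = g y) -> is_derive f x l -> is_derive g x l.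
Proof. intros Hx H. apply is_derive_ext_loc, locally_pos; assumption. Qed.

(** The first clause is delta m_k = m_(k+1), the second makes division by every h_j legitimate; the
    Toda equations follow from these two. *)
Definition positive_flow (m : R -> nat -> R) : Prop :=
  (forall x k, 0 < x -> is_derive (fun y => m y k) x (m x (S k) / x)) /\
  (forall x j, 0 < x -> 0 < hnorm (m x) j).

(** Encodes delta f = l at x through the ordinary derivative l / x, so that the usual rules
    transfer. *)
Definition euler_derive (f : R -> R) (x l : R) : Prop := is_derive f x (l / x).

Lemma euler_derive_eq (f : R -> R) (x l l' : R) :
  euler_derive f x l -> l = l' -> euler_derive f x l'.
Proof. intros H <-. exact H. Qed.

Lemma euler_derive_ext (f g : R -> R) (x l : R) :
  (forall y, f y = g y) -> euler_derive f x l -> euler_derive g x l.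
Proof. intros H. apply is_derive_ext, H. Qed.

Lemma euler_derive_unique (f : R -> R) (x l l' : R) :
  0 < x -> euler_derive f x l -> euler_derive f x l' -> l = l'.
Proof.
  intros Hx H H'. apply is_derive_unique in H. apply is_derive_unique in H'.
  rewrite H in H'. apply (f_equal (fun t => t * x)) in H'. field_simplify in H'; lra.
Qed.

Lemma euler_derive_const (c x : R) : euler_derive (fun _ => c) x 0.
Proof.
  unfold euler_derive. replace (0 / x) with 0 by (unfold Rdiv; ring).
  apply (is_derive_const (V := R_NormedModule)).
Qed.

Lemma euler_derive_id (x : R) : 0 < x -> euler_derive (fun y => y) x x.
Proof.
  intros Hx. unfold euler_derive. replace (x / x) with 1 by (field; lra).
  apply (is_derive_id (K := R_AbsRing)).
Qed.

Lemma euler_derive_plus (f g : R -> R) (x a b : R) :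
  euler_derive f x a -> euler_derive g x b -> euler_derive (fun y => f y + g y) x (a + b).
Proof.
  intros Hf Hg. unfold euler_derive. replace ((a + b) / x) with (a / x + b / x) by (unfold Rdiv; ring).
  apply (is_derive_plus (V := R_NormedModule)); assumption.
Qed.

Lemma euler_derive_minus (f g : R -> R) (x a b : R) :
  euler_derive f x a -> euler_derive g x b -> euler_derive (fun y => f y - g y) x (a - b).
Proof.
  intros Hf Hg. unfold euler_derive. replace ((a - b) / x) with (a / x - b / x) by (unfold Rdiv; ring).
  apply (is_derive_minus (V := R_NormedModule)); assumption.
Qed.

Lemma euler_derive_mult (f g : R -> R) (x a b : R) :
  euler_derive f x a -> euler_derive g x b ->
  euler_derive (fun y => f y * g y) x (a * g x + f x * b).
Proof.
  intros Hf Hg. unfold euler_derive.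
  replace ((a * g x + f x * b) / x) with (a / x * g x + f x * (b / x)) by (unfold Rdiv; ring).
  apply (is_derive_mult (K := R_AbsRing)); try assumption. intros; apply Rmult_comm.
Qed.

Lemma euler_derive_div (f g : R -> R) (x a b : R) :
  g x <> 0 -> euler_derive f x a -> euler_derive g x b ->
  euler_derive (fun y => f y / g y) x (a / g x - f x * b / (g x) ^ 2).
Proof.
  intros Hx Hf Hg. unfold euler_derive.
  replace ((a / g x - f x * b / g x ^ 2) / x) with ((a / x * g x - f x * (b / x)) / g x ^ 2)
    by (unfold Rdiv; set (i := / x); field; exact Hx).
  apply is_derive_div; assumption.
Qed.

(** * Toda equations *)

Section Flow.
Variable m : R -> nat -> R.
Hypothesis flow : positive_flow m.

Lemma flow_hnorm (x : R) (j : nat) : 0 < x -> hnorm (m x) j <> 0.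
Proof. intros Hx. pose proof (proj2 flow x j Hx). lra. Qed.

Lemma flow_low (x : R) (j k : nat) : 0 < x -> (k < j)%nat -> cheb (m x) j k = 0.
Proof. intros Hx. apply cheb_low. intros i _. apply flow_hnorm, Hx. Qed.

(** Reflects delta P_j = - b_j P_(j-1), which cancels the b term of x P_j. It is a predicate because
    rows j and j + 1 yield the derivatives of a_(j+1) and b_(j+1), which row j + 2 then needs. *)
Definition row_derive (j : nat) : Prop := forall x k, 0 < x ->
  euler_derive (fun y => cheb (m y) j k) x
    (cheb (m x) (S j) k + alph (m x) j * cheb (m x) j k).

Lemma row_hnorm_derive (x : R) (j : nat) : row_derive j -> 0 < x ->
  euler_derive (fun y => hnorm (m y) j) x (alph (m x) j * hnorm (m x) j).
Proof.
  intros H Hx. apply euler_derive_eq with (1 := H x j Hx).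
  rewrite flow_low by (lia || assumption). unfold hnorm. ring.
Qed.

(** In the quotient rule the two a_j terms cancel and h_(j+1) / h_j remains; this becomes delta S_n
    = b_n. *)
Lemma row_gsum_derive (x : R) (j : nat) : row_derive j -> 0 < x ->
  euler_derive (fun y => gsum (m y) j) x (bet (m x) j).
Proof.
  intros H Hx. eapply euler_derive_eq.
  - apply euler_derive_div; [apply flow_hnorm, Hx|apply H, Hx|apply row_hnorm_derive; assumption].
  - unfold bet. change (cheb (m x) (S j) (S j)) with (hnorm (m x) (S j)).
    pose proof (flow_hnorm x j Hx). field. assumption.
Qed.

Lemma row_bet_derive (x : R) (j : nat) : row_derive j -> row_derive (S j) -> 0 < x ->
  euler_derive (fun y => bet (m y) j) x
    (bet (m x) j * (alph (m x) (S j) - alph (m x) j)).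
Proof.
  intros H H' Hx. eapply euler_derive_eq.
  - apply euler_derive_div; [apply flow_hnorm, Hx| |]; apply row_hnorm_derive; assumption.
  - unfold bet. pose proof (flow_hnorm x j Hx). field. assumption.
Qed.

Lemma row_alph_derive_succ (x : R) (j : nat) : row_derive j -> row_derive (S j) -> 0 < x ->
  euler_derive (fun y => alph (m y) (S j)) x (bet (m x) (S j) - bet (m x) j).
Proof. intros H H' Hx. apply euler_derive_minus; apply row_gsum_derive; assumption. Qed.

Lemma cheb_derive (j : nat) : row_derive j.
Proof.
  induction j as [| |j IH1 IH2] using nat_pair_ind; intros x k Hx.
  - apply euler_derive_eq with (1 := proj1 flow x k Hx). rewrite cheb_1. simpl cheb. ring.
  - assert (H0 : row_derive 0).
    { intros y l Hy. apply euler_derive_eq with (1 := proj1 flow y l Hy).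
      rewrite cheb_1. simpl cheb. ring. }
    assert (Ha : euler_derive (fun y => alph (m y) 0) x (bet (m x) 0)).
    { apply euler_derive_ext with (fun y => gsum (m y) 0); [intros; unfold alph; ring|].
      apply row_gsum_derive; assumption. }
    apply euler_derive_ext with (fun y => cheb (m y) 0 (S k) - alph (m y) 0 * cheb (m y) 0 k);
      [intros; symmetry; apply cheb_1|].
    eapply euler_derive_eq.
    + apply euler_derive_minus; [apply H0, Hx|].
      apply euler_derive_mult; [exact Ha|apply H0, Hx].
    + rewrite cheb_SS, !cheb_1. ring.
  - apply euler_derive_ext with (fun y => cheb (m y) (S j) (S k)
      - alph (m y) (S j) * cheb (m y) (S j) k - bet (m y) j * cheb (m y) j k);
      [intros; symmetry; apply cheb_SS|].
    eapply euler_derive_eq.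
    + apply euler_derive_minus; [apply euler_derive_minus; [apply IH2, Hx|]|];
        apply euler_derive_mult.
      * apply row_alph_derive_succ; assumption.
      * apply IH2, Hx.
      * apply row_bet_derive; assumption.
      * apply IH1, Hx.
    + rewrite (cheb_SS _ (S j) k), !(cheb_SS _ j). ring.
Qed.

Lemma hnorm_derive (x : R) (j : nat) : 0 < x ->
  euler_derive (fun y => hnorm (m y) j) x (alph (m x) j * hnorm (m x) j).
Proof. intros Hx. apply row_hnorm_derive; [apply cheb_derive|exact Hx]. Qed.

Lemma gsum_derive (x : R) (j : nat) : 0 < x ->
  euler_derive (fun y => gsum (m y) j) x (bet (m x) j).
Proof. intros Hx. apply row_gsum_derive; [apply cheb_derive|exact Hx]. Qed.

Lemma bet_derive (x : R) (j : nat) : 0 < x ->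
  euler_derive (fun y => bet (m y) j) x (bet (m x) j * (alph (m x) (S j) - alph (m x) j)).
Proof. intros Hx. apply row_bet_derive; try apply cheb_derive; exact Hx. Qed.

Lemma shiftT_cheb_derive (x : R) (j k : nat) : 0 < x ->
  euler_derive (fun y => shiftT k (cheb (m y) j)) x
    (shiftT k (cheb (m x) (S j)) + alph (m x) j * shiftT k (cheb (m x) j)).
Proof.
  intros Hx. unfold euler_derive.

  replace ((shiftT k (cheb (m x) (S j)) + alph (m x) j * shiftT k (cheb (m x) j)) / x)
    with (shiftT k (fun l => / x * cheb (m x) (S j) l + (alph (m x) j / x) * cheb (m x) j l))
    by (rewrite shiftT_lin; field; lra).
  apply is_derive_shiftT. intros l.
  replace (/ x * cheb (m x) (S j) l + alph (m x) j / x * cheb (m x) j l)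
    with ((cheb (m x) (S j) l + alph (m x) j * cheb (m x) j l) / x) by (field; lra).
  apply cheb_derive, Hx.
Qed.

Lemma shiftT_cheb_diag (x : R) (j : nat) : 0 < x ->
  shiftT j (cheb (m x) j) = hnorm (m x) j.
Proof. intros Hx. apply (shiftT_low j (cheb (m x) j)). intros l Hl. apply flow_low; assumption. Qed.

Lemma shiftT_cheb_low (x : R) (j k : nat) : 0 < x -> (k < j)%nat ->
  shiftT k (cheb (m x) j) = 0.
Proof.
  intros Hx Hk. rewrite shiftT_low; intros; apply flow_low; (assumption || lia).
Qed.

(** * Structure relations from the Bessel equation *)

Variable beta : R.
Hypothesis bessel : forall x k, 0 < x ->
  m x (S (S k)) + beta * m x (S k) = x * shiftT k (m x).

(* [b_(n+1) * b_n] in the usual indexing, where [b_0 = 0]. *)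
Definition betQ (x : R) (n : nat) : R :=
  match n with O => 0 | S i => bet (m x) (S i) * bet (m x) i end.

Definition tail_term (x : R) (n k : nat) : R :=
  match n with O => 0 | S i => betQ x n * shiftT k (cheb (m x) i) end.

(** The logarithmic derivative of [betQ] is a_(n+1) - a_(n-1) and row n - 1 contributes a_(n-1).
    Only a_(n+1) is left, the same factor as in the derivative of row n + 1. *)
Lemma tail_term_derive (x : R) (n k : nat) : 0 < x ->
  euler_derive (fun y => tail_term y n k) x
    (alph (m x) (S n) * tail_term x n k + betQ x n * shiftT k (cheb (m x) n)).
Proof.
  intros Hx. destruct n as [|i].
  - apply euler_derive_eq with (1 := euler_derive_const 0 x). simpl. ring.
  - eapply euler_derive_eq.
    + apply (euler_derive_mult (fun y => bet (m y) (S i) * bet (m y) i));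
        [apply euler_derive_mult; apply bet_derive, Hx|apply shiftT_cheb_derive, Hx].
    + unfold tail_term, betQ. ring.
Qed.

(* With [w (i - 1) z = i (i + beta) w i] for the weight, this expresses
   [P_(n+1)(x + 1) = P_(n+1) + (n+1) P_n + (betQ n / z) P_(n-1)]. *)
Definition pearson (n : nat) : Prop := forall x k, 0 < x ->
  cheb (m x) (S n) (S (S k)) + beta * cheb (m x) (S n) (S k) =
  x * shiftT k (cheb (m x) (S n)) + x * INR (S n) * shiftT k (cheb (m x) n) + tail_term x n k.

(** Apply delta to the Bessel relation and subtract a_0 times that relation. *)
Lemma pearson_0 : pearson 0.
Proof.
  intros x k Hx.
  assert (HL : euler_derive (fun y => m y (S (S k)) + beta * m y (S k)) x
     (cheb (m x) 1 (S (S k)) + alph (m x) 0 * cheb (m x) 0 (S (S k))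
      + beta * (cheb (m x) 1 (S k) + alph (m x) 0 * cheb (m x) 0 (S k)))).
  { apply euler_derive_plus; [apply (cheb_derive 0), Hx|].
    eapply euler_derive_eq; [apply euler_derive_mult; [apply euler_derive_const|apply (cheb_derive 0), Hx]|].
    change (cheb (m x) 0) with (m x). cbv beta. ring. }
  assert (HR : euler_derive (fun y => y * shiftT k (m y)) x
     (x * shiftT k (m x) + x * (shiftT k (cheb (m x) 1) + alph (m x) 0 * shiftT k (m x)))).
  { apply euler_derive_mult; [apply euler_derive_id, Hx|apply (shiftT_cheb_derive x 0), Hx]. }
  assert (HR' : euler_derive (fun y => m y (S (S k)) + beta * m y (S k)) x
     (x * shiftT k (m x) + x * (shiftT k (cheb (m x) 1) + alph (m x) 0 * shiftT k (m x)))).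
  { apply is_derive_ext_pos with (3 := HR); [exact Hx|].
    intros y Hy. symmetry. now apply bessel. }
  pose proof (euler_derive_unique _ _ _ _ Hx HL HR') as E.
  pose proof (bessel x k Hx) as E0. simpl tail_term. simpl INR.
  change (cheb (m x) 0) with (m x) in *.
  apply (f_equal (Rmult (alph (m x) 0))) in E0. lra.
Qed.

(* Differentiating [pearson n] determines the next relation up to one coefficient,
   which the entry [k = n] identifies. *)
Lemma pearson_succ_aux (n : nat) : pearson n -> forall x k, 0 < x ->
  cheb (m x) (S (S n)) (S (S k)) + beta * cheb (m x) (S (S n)) (S k) =
  x * shiftT k (cheb (m x) (S (S n))) + x * INR (S (S n)) * shiftT k (cheb (m x) (S n))
  + (betQ x n + x * INR (S n) * (1 + alph (m x) n - alph (m x) (S n))) * shiftT k (cheb (m x) n).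
Proof.
  intros HP x k Hx.
  assert (HL := euler_derive_plus _ _ _ _ _ (cheb_derive (S n) x (S (S k)) Hx)
    (euler_derive_mult _ _ _ _ _ (euler_derive_const beta x) (cheb_derive (S n) x (S k) Hx))).
  assert (HR := euler_derive_plus _ _ _ _ _ (euler_derive_plus _ _ _ _ _
    (euler_derive_mult _ _ _ _ _ (euler_derive_id x Hx) (shiftT_cheb_derive x (S n) k Hx))
    (euler_derive_mult _ _ _ _ _
       (euler_derive_mult _ _ _ _ _ (euler_derive_id x Hx) (euler_derive_const (INR (S n)) x))
       (shiftT_cheb_derive x n k Hx)))
    (tail_term_derive x n k Hx)).
  apply (is_derive_ext_pos _ (fun y => cheb (m y) (S n) (S (S k)) + beta * cheb (m y) (S n) (S k)))
    in HR; [|exact Hx|intros y Hy; symmetry; now apply HP].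
  pose proof (euler_derive_unique _ _ _ _ Hx HL HR) as E.
  pose proof (HP x k Hx) as E0.
  (* Subtracting a_(n+1) times [pearson n] removes the tail and leaves only rows n + 2, n + 1 and
     n. *)
  apply (f_equal (Rmult (alph (m x) (S n)))) in E0.
  rewrite (S_INR (S n)). lra.
Qed.

(** At k = n the shifted rows n + 2 and n + 1 vanish, so the unknown coefficient is h_(n+2) /
    h_n. *)
Lemma betQ_succ_aux (n : nat) (x : R) : pearson n -> 0 < x ->
  betQ x (S n) = betQ x n + x * INR (S n) * (1 + alph (m x) n - alph (m x) (S n)).
Proof.
  intros HP Hx. pose proof (pearson_succ_aux n HP x n Hx) as E.
  rewrite (flow_low x (S (S n)) (S n)) in E by (lia || assumption).
  rewrite !(shiftT_cheb_low x _ n), shiftT_cheb_diag in E by (lia || assumption).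
  change (cheb (m x) (S (S n)) (S (S n))) with (hnorm (m x) (S (S n))) in E.
  pose proof (flow_hnorm x n Hx). pose proof (flow_hnorm x (S n) Hx).
  transitivity (hnorm (m x) (S (S n)) / hnorm (m x) n).
  - simpl. unfold bet. field. split; assumption.
  - apply (Rmult_eq_reg_r (hnorm (m x) n)); [|assumption].
    rewrite !Rmult_0_r, !Rplus_0_r, !Rplus_0_l in E. rewrite <- E. field. assumption.
Qed.

Lemma pearson_all (n : nat) : pearson n.
Proof.
  induction n as [|n IH]; [exact pearson_0|].
  intros x k Hx. rewrite (pearson_succ_aux n IH x k Hx), <- betQ_succ_aux by assumption.
  reflexivity.
Qed.

Lemma betQ_succ (n : nat) (x : R) : 0 < x ->
  betQ x (S n) = betQ x n + x * INR (S n) * (1 + alph (m x) n - alph (m x) (S n)).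
Proof. apply betQ_succ_aux, pearson_all. Qed.

(** The entry k = n of [pearson n]: the left side gives h_(n+1) ([gsum] at n+1, plus beta), the tail
    gives h_(n+1) ([gsum] at n-1, plus n), and the two sums differ by a_n + a_(n+1). *)
Lemma alph_sum (n : nat) (x : R) : 0 < x ->
  bet (m x) n * (alph (m x) (S n) + alph (m x) n + beta - INR n) = INR (S n) * x.
Proof.
  intros Hx. pose proof (pearson_all n x n Hx) as E.
  rewrite (shiftT_cheb_low x (S n) n), shiftT_cheb_diag in E by (lia || assumption).
  pose proof (flow_hnorm x n Hx) as Hn. pose proof (flow_hnorm x (S n) Hx) as HSn.
  assert (E1 : cheb (m x) (S n) (S (S n)) = gsum (m x) (S n) * hnorm (m x) (S n))
    by (unfold gsum; field; assumption).
  rewrite E1 in E. change (cheb (m x) (S n) (S n)) with (hnorm (m x) (S n)) in E.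
  assert (ET : tail_term x n n =
     hnorm (m x) (S n) * match n with O => 0 | S i => gsum (m x) i + INR n end).
  { destruct n as [|i]; [simpl; ring|]. simpl tail_term. unfold betQ.
    assert (Hi := flow_hnorm x i Hx).
    change (shiftT i (cheb (m x) i) + shiftT i (fun l => cheb (m x) i (S l)))
      with (shiftT (S i) (cheb (m x) i)).
    rewrite shiftT_low_succ by (intros; apply flow_low; assumption).
    unfold bet, gsum. change (cheb (m x) i i) with (hnorm (m x) i). field. split; assumption. }
  rewrite ET in E.
  assert (E2 : alph (m x) (S n) + alph (m x) n =
    gsum (m x) (S n) - match n with O => 0 | S i => gsum (m x) i end)
    by (unfold alph; destruct n; ring).
  rewrite E2. unfold bet.
  apply (Rmult_eq_reg_r (hnorm (m x) n)); [|assumption].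
  transitivity (hnorm (m x) (S n) * (gsum (m x) (S n) -
     match n with O => 0 | S i => gsum (m x) i end + beta - INR n)); [field; assumption|].
  destruct n as [|i]; [simpl in *; lra|]. lra.
Qed.

(** * First integrals and elimination *)

Definition bet_prev (x : R) (n : nat) : R :=
  match n with O => 0 | S i => bet (m x) i end.

Lemma betQ_eq (x : R) (n : nat) : betQ x n = bet (m x) n * bet_prev x n.
Proof. destruct n; simpl; ring. Qed.

(** The case n = 0 is the Bessel equation at k = 0. In the step, both sides change by the same
    multiple of 1 + a_n - a_(n+1), thanks to [alph_sum] and [betQ_succ]. *)
Lemma bet_charlier (n : nat) (x : R) : 0 < x ->
  (bet (m x) n - x) * (bet_prev x n - x)
  = x * (alph (m x) n - INR n) * (alph (m x) n - INR n + beta).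
Proof.
  intros Hx. induction n as [|n IH].
  - pose proof (bessel x 0 Hx) as E. simpl shiftT in E. simpl bet_prev. simpl INR.
    pose proof (flow_hnorm x 0 Hx) as H0.
    unfold bet, alph, gsum. unfold hnorm at 1. rewrite cheb_1. unfold alph, gsum.
    unfold hnorm in *. simpl cheb in *.
    replace (m x 2%nat) with (x * m x 0%nat - beta * m x 1%nat) by lra.
    field. assumption.
  - pose proof (alph_sum n x Hx) as E1.
    pose proof (betQ_succ n x Hx) as E2. rewrite !betQ_eq in E2. simpl bet_prev in *.
    assert (Hb : bet (m x) n <> 0).
    { intros H. rewrite H in E1. assert (0 < INR (S n)) by apply lt_0_INR, Nat.lt_0_succ. nra. }
    rewrite S_INR in *.
    set (b := bet (m x) n) in *. set (b1 := bet (m x) (S n)) in *. set (b0 := bet_prev x n) in *.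
    set (a := alph (m x) n) in *. set (a1 := alph (m x) (S n)) in *. set (N := INR n) in *.
    (* This is [betQ_succ] divided by b, after [alph_sum] has replaced x (N+1). *)
    assert (Hb1 : b1 = b0 + (a1 + a + beta - N) * (1 + a - a1)).
    { apply (Rmult_eq_reg_l b); [|assumption].
      replace (b * (b0 + (a1 + a + beta - N) * (1 + a - a1)))
        with (b * b0 + (b * (a1 + a + beta - N)) * (1 + a - a1)) by ring.
      rewrite E1. lra. }
    replace ((b1 - x) * (b - x)) with
      ((b - x) * (b0 - x) + (b * (a1 + a + beta - N) - x * (a1 + a + beta - N)) * (1 + a - a1))
      by (rewrite Hb1; ring).
    rewrite IH, E1. ring.
Qed.

(** Summation of [betQ_succ] over n by parts. *)
Lemma gsum_eq (n : nat) (x : R) : 0 < x ->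
  x * (gsum (m x) n - INR n * INR (S n) / 2)
  = betQ x (S n) + x * INR (S n) * (alph (m x) (S n) - INR (S n)).
Proof.
  intros Hx. induction n as [|n IH].
  - rewrite (betQ_succ 0 x Hx). replace (alph (m x) 0) with (gsum (m x) 0) by (unfold alph; ring).
    simpl. field.
  - rewrite (betQ_succ (S n) x Hx).
    replace (gsum (m x) (S n)) with (gsum (m x) n + alph (m x) (S n)) by (unfold alph; ring).
    rewrite !S_INR in *. lra.
Qed.

(* Here [n = p + 1], [S_n = gsum p] and [z S_n' = bet p]. *)
Lemma sigma_form (p : nat) (z : R) : 0 < z ->
  let n := INR (S p) in
  let s := bet (m z) p / z in
  (s * (alph (m z) (S p) - alph (m z) p - 1)) ^ 2 =
  (n - (n + beta) * s) ^ 2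
  - 4 * s * (s - 1) * (z * s - gsum (m z) p + n * (n - 1) / 2).
Proof.
  intros Hz n s.
  pose proof (alph_sum p z Hz) as E1.
  pose proof (bet_charlier (S p) z Hz) as E2. simpl bet_prev in E2.
  pose proof (gsum_eq p z Hz) as E5. unfold betQ in E5.
  assert (Hb : bet (m z) p = z * s) by (unfold s; field; lra).
  assert (Hp : INR p = n - 1) by (unfold n; rewrite S_INR; ring).
  fold n in E1, E2, E5. rewrite Hp in *. rewrite Hb in *.
  set (a := alph (m z) p) in *. set (a1 := alph (m z) (S p)) in *.
  set (b1 := bet (m z) (S p)) in *. set (G := gsum (m z) p) in *.
  assert (E1' : s * (a1 + a + beta - n + 1) = n).
  { apply (Rmult_eq_reg_l z); [|lra]. lra. }
  assert (E2' : (b1 - z) * (s - 1) = (a1 - n) * (a1 - n + beta)).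
  { apply (Rmult_eq_reg_l z); [|lra]. lra. }
  assert (E5' : G = n * (n - 1) / 2 + b1 * s + n * (a1 - n)).
  { apply (Rmult_eq_reg_l z); [|lra]. lra. }
  (* Here [b1] is eliminated: E5' brings in (b1 - z)(s - 1), which E2' evaluates in terms of
     [a1]. *)
  assert (E4 : s * (a - n + 1) * (a1 - n) = (s - 1) * (z * s - G + n * (n - 1) / 2)).
  { replace (s * (a - n + 1) * (a1 - n))
      with ((s * (a1 + a + beta - n + 1) - s * (a1 + beta)) * (a1 - n)) by ring.
    replace ((s - 1) * (z * s - G + n * (n - 1) / 2))
      with (- s * ((b1 - z) * (s - 1)) - n * (a1 - n) * (s - 1)) by (rewrite E5'; ring).
    rewrite E1', E2'. ring. }
  rewrite Rmult_assoc with (r3 := z * s - G + n * (n - 1) / 2).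
  rewrite <- E4.
  (* With u = a1 - n and v = a - n + 1, the claim is now s^2 times (u - v)^2 = (u + v)^2 - 4 u v. *)
  replace (n - (n + beta) * s) with (s * (a1 + a + beta - n + 1) - (n + beta) * s) by (rewrite E1'; ring).
  ring.
Qed.
End Flow.

(** * The Hankel determinant *)

Module LaplaceDet.
Import all_boot all_algebra Rstruct.
Import GRing.Theory.
Local Open Scope ring_scope.

Lemma sum_f_R0_big (f : nat -> R) (n : nat) :
  sum_f_R0 f n = \sum_(i < n.+1) f i.
Proof.
elim: n => [|n IHn] /=; first by rewrite big_ord_recl big_ord0 addr0.
by rewrite big_ord_recr /= IHn.
Qed.

Lemma prod_f_R0_big (f : nat -> R) (n : nat) :
  prod_f_R0 f n = \prod_(i < n.+1) f i.
Proof.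
elim: n => [|n IHn] /=; first by rewrite big_ord_recl big_ord0 mulr1.
by rewrite big_ord_recr /= IHn.
Qed.

Lemma det_determinant (n : nat) (A : nat -> nat -> R) :
  det n A = \det (\matrix_(i < n, j < n) A i j).
Proof.
elim: n A => [|n IHn] A; first by rewrite det_mx00.
rewrite (expand_det_row _ ord0) [LHS]/= sum_f_R0_big.
apply: eq_bigr => j _; rewrite IHn !mxE /cofactor add0n RpowE.
rewrite !RmultE (_ : IZR (-1) = -1) // [_ ^+ _ * _]mulrC -mulrA; congr (_ * (_ * \det _)).
(* The minors agree because the conditional skipping column j is the map [bump j]. *)
apply/matrixP => i k; rewrite !mxE /= /bump leq0n add1n.
congr (A _ _).
case: Nat.ltb_spec => [/ltP|/leP] H.
  by rewrite leqNgt H.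
by rewrite H.
Qed.

(** Triangular elimination: U has determinant 1 and U A = T is upper triangular. The sums stop at i
    since U vanishes beyond the diagonal. *)
Lemma det_unit_lower_mul (n : nat) (U A T : nat -> nat -> R) :
  (forall i, U i i = 1) ->
  (forall i l, (i < l)%coq_nat -> U i l = 0) ->
  (forall i j, sum_f_R0 (fun l => U i l * A l j) i = T i j) ->
  (forall i j, (j < i)%coq_nat -> T i j = 0) ->
  det n.+1 A = prod_f_R0 (fun i => T i i) n.
Proof.
move=> U1 U0 UA T0; rewrite det_determinant.
set mA := \matrix_(i, j) _.
pose mU : 'M[R]_n.+1 := \matrix_(i, j) U i j.
pose mT : 'M[R]_n.+1 := \matrix_(i, j) T i j.
have EU : \det mU = 1.
  rewrite det_trig; last by apply/is_trig_mxP => i j ij; rewrite mxE U0 //; apply/ltP.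
  by rewrite big1 // => i _; rewrite mxE U1.
have ET : \det mT = prod_f_R0 (fun i => T i i) n.
  rewrite -det_tr det_trig; last by apply/is_trig_mxP => i j ij; rewrite !mxE T0 //; apply/ltP.
  rewrite prod_f_R0_big; by apply: eq_bigr => i _; rewrite !mxE.
have E : mU *m mA = mT.
  apply/matrixP => i j; rewrite !mxE -UA sum_f_R0_big.
  rewrite -(big_mkord xpredT (fun l => U i l * A l j)%R).
  rewrite (eq_bigr (fun l : 'I_n.+1 => U i l * A l j)); last by move=> l _; rewrite !mxE.
  rewrite -(big_mkord xpredT (fun l => U i l * A l j)%R).
  rewrite [LHS](@big_cat_nat _ _ _ i.+1) //=.
  rewrite [X in _ + X]big_nat_cond [X in _ + X]big1 ?addr0 // => l.
  by rewrite andbT => /andP[il _]; rewrite U0 ?mul0r //; apply/ltP.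
by rewrite -ET -E det_mulmx EU mul1r.
Qed.
End LaplaceDet.

Lemma sum_f_R0_support (f : nat -> R) (a b : nat) :
  (a <= b)%nat -> (forall l, (a < l)%nat -> f l = 0) -> sum_f_R0 f b = sum_f_R0 f a.
Proof.
  intros Hab Hf. induction Hab as [|b Hab IH]; [reflexivity|].
  simpl. rewrite IH, Hf by lia. ring.
Qed.

Lemma sum_f_R0_comb3 (a b : R) (u v t : nat -> R) (n : nat) :
  sum_f_R0 (fun l => u l - a * v l - b * t l) n
  = sum_f_R0 u n - a * sum_f_R0 v n - b * sum_f_R0 t n.
Proof. induction n as [|n IH]; simpl; [|rewrite IH]; ring. Qed.

(** The witness u lists the coefficients of the monic P_j, built by the three-term recurrence;
    multiplication by x shifts the list by one place. *)
Lemma cheb_comb (m : nat -> R) (j : nat) :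
  exists u : nat -> R, u j = 1 /\ (forall l, (j < l)%nat -> u l = 0) /\
    forall k, sum_f_R0 (fun l => u l * m (l + k)%nat) j = cheb m j k.
Proof.
  assert (Hshift : forall (u : nat -> R) i k,
     sum_f_R0 (fun l => (match l with O => 0 | S l' => u l' end) * m (l + k)%nat) (S i)
     = sum_f_R0 (fun l => u l * m (l + S k)%nat) i).
  { intros u i k. rewrite decomp_sum by lia. simpl pred. rewrite Rmult_0_l, Rplus_0_l.
    apply sum_eq. intros l _. do 2 f_equal. lia. }
  induction j as [| |j [u1 [H1 [L1 E1]]] [u2 [H2 [L2 E2]]]] using nat_pair_ind.
  - exists (fun l => match l with O => 1 | S _ => 0 end).
    split; [reflexivity|split; [intros [|l] Hl; [lia|reflexivity]|]].
    intros k. simpl. ring.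
  - exists (fun l => match l with O => - alph m 0 | S O => 1 | _ => 0 end).
    split; [reflexivity|split; [intros [|[|l]] Hl; try lia; reflexivity|]].
    intros k. rewrite cheb_1. simpl. ring.
  - exists (fun l => (match l with O => 0 | S l' => u2 l' end) - alph m (S j) * u2 l - bet m j * u1 l).
    split; [rewrite H2, L2, L1 by lia; ring|split].
    + intros [|l] Hl; [lia|]. rewrite L1, !L2 by lia. ring.
    + intros k. rewrite cheb_SS, <- E2, <- E2, <- E1.
      rewrite <- Hshift.
      rewrite <- (sum_f_R0_support (fun l => u2 l * m (l + k)%nat) (S j) (S (S j)));
        [|lia|intros; rewrite L2 by assumption; ring].
      rewrite <- (sum_f_R0_support (fun l => u1 l * m (l + k)%nat) j (S (S j)));
        [|lia|intros; rewrite L1 by assumption; ring].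
      rewrite <- sum_f_R0_comb3. apply sum_eq. intros l _. ring.
Qed.

(** Multiplying the Hankel matrix by the coefficient rows of the P_j gives the table [cheb m], upper
    triangular by orthogonality with diagonal h_j. *)
Lemma det_hankel (m : nat -> R) (p : nat) :
  (forall i, hnorm m i <> 0) ->
  det (S p) (fun j k => m (j + k)%nat) = prod_f_R0 (hnorm m) p.
Proof.
  intros Hh.
  set (U := fun j => proj1_sig (constructive_indefinite_description _ (cheb_comb m j))).
  assert (HU : forall j, U j j = 1 /\ (forall l, (j < l)%nat -> U j l = 0) /\
    forall k, sum_f_R0 (fun l => U j l * m (l + k)%nat) j = cheb m j k)
    by (intros j; exact (proj2_sig (constructive_indefinite_description _ (cheb_comb m j)))).
  apply (LaplaceDet.det_unit_lower_mul p U _ (cheb m)).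
  - intros i. apply HU.
  - intros i. apply HU.
  - intros i. apply HU.
  - intros i j Hij. apply cheb_low; auto.
Qed.

Lemma det_scal (n : nat) (c : R) (A : nat -> nat -> R) :
  det n (fun j k => c * A j k) = c ^ n * det n A.
Proof.
  revert A; induction n as [|n IH]; intros A; simpl; [ring|].
  rewrite scal_sum. apply sum_eq. intros j _.
  rewrite (IH (fun i k => A (S i) (if Nat.ltb k j then k else S k))). ring.
Qed.

Lemma det_ext (n : nat) (A B : nat -> nat -> R) :
  (forall j k, A j k = B j k) -> det n A = det n B.
Proof.
  revert A B; induction n as [|n IH]; intros A B H; simpl; [reflexivity|].
  apply sum_eq. intros j _. rewrite H. f_equal. apply IH. intros; apply H.
Qed.

(** * The theorem *)

(** An actual derivative determines the value chosen by [epsilon], by uniqueness; likewise for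
    [series] below. *)
Lemma Deriv_eq (f : R -> R) (x l : R) : is_derive f x l -> Deriv f x = l.
Proof.
  intros H. apply is_derive_Reals in H.
  assert (H' : derivable_pt_lim f x (Deriv f x))
    by (apply (epsilon_spec (inhabits 0) (fun l => derivable_pt_lim f x l)); exists l; exact H).
  exact (uniqueness_limite _ _ _ _ H' H).
Qed.

Lemma series_eq (a : nat -> R) (l : R) : infinite_sum a l -> series a = l.
Proof.
  intros H.
  assert (H' : infinite_sum a (series a))
    by (apply (epsilon_spec (inhabits 0) (fun l => infinite_sum a l)); exists l; exact H).
  exact (uniqueness_sum _ _ _ H' H).
Qed.

(** Since (sqrt x)^(2i+beta) = x^i x^(beta/2), the prefactor x^(-beta/2) leaves a power series in
    x. *)
Lemma psi_mom (beta x : R) : -1 < beta -> 0 < x ->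
  psi_beta beta x = / Gamma (beta + 1) * mom beta x 0.
Proof.
  intros Hb Hx. unfold psi_beta, BesselI.
  set (P := Rpower x (beta / 2) / Gamma (beta + 1)).
  assert (HG : 0 < Gamma (beta + 1)) by (apply Gamma_spec; lra).
  assert (E : forall i, P * (mom_coef beta 0 i * x ^ i) =
    Rpower (2 * sqrt x / 2) (2 * INR i + beta) / (INR (fact i) * Gamma (INR i + beta + 1))).
  { intros i. unfold Rdiv at 1. rewrite coef_Gamma by exact Hb.
    replace (2 * sqrt x / 2) with (sqrt x) by field.
    rewrite <- Rpower_sqrt, Rpower_mult by exact Hx.
    replace (/ 2 * (2 * INR i + beta)) with (INR i + beta / 2) by field.
    rewrite Rpower_plus, Rpower_pow by exact Hx.
    unfold P, mom_coef. simpl. field. lra. }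
  rewrite (series_eq _ (P * mom beta x 0)).
  - unfold P. unfold Rdiv. rewrite <- !Rmult_assoc, <- Rpower_plus.
    replace (- beta * / 2 + beta * / 2) with 0 by field.
    rewrite Rpower_O by exact Hx. ring.
  - apply is_series_Reals. apply (is_series_ext _ _ _ E).
    apply (is_series_scal (V := R_NormedModule)). apply Series_correct, ex_series_mom, Hb.
Qed.

Lemma delta_iter_mom (beta x : R) (k : nat) : -1 < beta -> 0 < x ->
  delta_iter k (psi_beta beta) x = / Gamma (beta + 1) * mom beta x k.
Proof.
  intros Hb. revert x. induction k as [|k IH]; intros x Hx; [now apply psi_mom|].
  simpl. unfold delta.
  rewrite (Deriv_eq _ x (/ Gamma (beta + 1) * (mom beta x (S k) / x))).
  - assert (0 < Gamma (beta + 1)) by (apply Gamma_spec; lra). field. lra.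
  - apply is_derive_ext_pos with (fun y => / Gamma (beta + 1) * mom beta y k);
      [exact Hx|intros; symmetry; now apply IH|].
    apply is_derive_scal, is_derive_mom; assumption.
Qed.

Lemma mom_flow (beta : R) : -1 < beta -> positive_flow (mom beta).
Proof.
  intros Hb. split.
  - intros x k Hx. now apply is_derive_mom.
  - intros x j Hx. apply (hnorm_pos _ (fun i => coef beta i * x ^ i)).
    + intros i. apply Rmult_lt_0_compat; [now apply coef_pos|now apply pow_lt].
    + intros k. apply ex_series_ext with (2 := ex_series_mom beta x k Hb).
      intros i. unfold mom_coef. simpl. ring.
    + intros k. unfold mom, PSeries. apply Series_ext. intros i. unfold mom_coef. ring.
Qed.

Lemma Delta_prod (beta x : R) (p : nat) : -1 < beta -> 0 < x ->
  Delta (S p) beta x = prod_f_R0 (hnorm (mom beta x)) p.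
Proof.
  intros Hb Hx. unfold Delta, Wronsk.
  rewrite (det_ext _ _ (fun j k => / Gamma (beta + 1) * mom beta x (j + k)))
    by (intros; now apply delta_iter_mom).
  rewrite det_scal, <- Rmult_assoc, <- Rpow_mult_distr.
  rewrite Rinv_r by (apply Rgt_not_eq, Gamma_spec; lra).
  rewrite pow1, Rmult_1_l. apply det_hankel. intros i.
  apply (flow_hnorm _ (mom_flow beta Hb) x i Hx).
Qed.

(** The logarithmic derivatives a_j of the factors add up to [gsum]; positivity is what [ln] will
    require. *)
Lemma prod_hnorm_derive (m : R -> nat -> R) (p : nat) (x : R) : positive_flow m -> 0 < x ->
  0 < prod_f_R0 (hnorm (m x)) p /\
  euler_derive (fun y => prod_f_R0 (hnorm (m y)) p) x (gsum (m x) p * prod_f_R0 (hnorm (m x)) p).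
Proof.
  intros Hm Hx. induction p as [|p [IHp IH]]; simpl.
  - split; [apply Hm, Hx|].
    eapply euler_derive_eq; [apply hnorm_derive; assumption|]. unfold alph. ring.
  - split; [apply Rmult_lt_0_compat; [exact IHp|apply Hm, Hx]|].
    eapply euler_derive_eq; [apply euler_derive_mult; [exact IH|apply hnorm_derive; assumption]|].
    unfold alph. ring.
Qed.

Lemma Sn_gsum (beta x : R) (p : nat) : -1 < beta -> 0 < x ->
  Sn (S p) beta x = gsum (mom beta x) p.
Proof.
  intros Hb Hx. unfold Sn.
  destruct (prod_hnorm_derive _ p x (mom_flow beta Hb) Hx) as [Hp Hd].
  rewrite (Deriv_eq _ x (gsum (mom beta x) p / x)); [field; lra|].
  apply is_derive_ext_pos with (fun y => ln (prod_f_R0 (hnorm (mom beta y)) p));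
    [exact Hx|intros y Hy; now rewrite Delta_prod|].
  eapply is_derive_ext; [intros; reflexivity|].
  replace (gsum (mom beta x) p / x) with
    (scal (gsum (mom beta x) p * prod_f_R0 (hnorm (mom beta x)) p / x)
       (/ prod_f_R0 (hnorm (mom beta x)) p)).
  - apply (is_derive_comp ln); [|exact Hd].
    apply is_derive_Reals, derivable_pt_lim_ln, Hp.
  - unfold scal; simpl; unfold mult; simpl. field. split; lra.
Qed.

Theorem theorem4p4 (beta : R) (n : nat) (z : R) :
  -1 < beta -> (1 <= n)%nat -> 0 < z ->
  let S := Sn n beta in
  let S1 := Deriv S in
  let S2 := Deriv S1 in
  (exists l, derivable_pt_lim S z l) /\
  (exists l, derivable_pt_lim S1 z l) /\
  (z * S2 z) ^ 2 =
    (INR n - (INR n + beta) * S1 z) ^ 2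
    - 4 * S1 z * (S1 z - 1)
        * (z * S1 z - S z + INR n * (INR n - 1) / 2).
Proof.
  intros Hb Hn Hz. destruct n as [|p]; [lia|].
  intros S' S1 S2. pose proof (mom_flow beta Hb) as Hm.
  assert (H0 : forall x, 0 < x -> is_derive S' x (bet (mom beta x) p / x)).
  { intros x Hx. apply is_derive_ext_pos with (fun y => gsum (mom beta y) p); [exact Hx| |].
    - intros y Hy. symmetry. now apply Sn_gsum.
    - now apply (gsum_derive _ Hm). }
  assert (H1 : forall x, 0 < x -> S1 x = bet (mom beta x) p / x)
    by (intros x Hx; apply Deriv_eq, H0, Hx).
  (* The Toda equation for b_n gives delta (b_n / z) = (b_n / z)(a_n - a_(n-1) - 1), which is z S''.
     The formula for S' is first established for all x > 0 so that it can be differentiated. *)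
  assert (H2 : is_derive S1 z
    (bet (mom beta z) p / z * (alph (mom beta z) (S p) - alph (mom beta z) p - 1) / z)).
  { apply is_derive_ext_pos with (fun y => bet (mom beta y) p / y);
      [exact Hz|intros y Hy; symmetry; now apply H1|].
    eapply euler_derive_eq.
    - apply (euler_derive_div (fun y => bet (mom beta y) p) (fun y => y));
        [lra|now apply (bet_derive _ Hm)|now apply euler_derive_id].
    - field. lra. }
  split; [|split].
  - eexists. apply is_derive_Reals, H0, Hz.
  - eexists. apply is_derive_Reals, H2.
  - unfold S2. rewrite (Deriv_eq _ _ _ H2), (H1 z Hz).
    unfold S'. rewrite (Sn_gsum beta z p Hb Hz).
    rewrite <- (sigma_form (mom beta) Hm beta) by (assumption || (intros; now apply mom_bessel)).
    field. lra.
Qed.
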